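(* Let $q\in(0,1)$ and let $p$ be a positive integer. Let $a,b,c,d,\alpha,\beta$ be positive real numbers such that $\beta d\leq \alpha b$ and such that, for every $t\in[0,\infty)$, $a+bt\leq c+dt$, $\psi_{p,q}(a+bt)>0$ and $\psi_{p,q}(c+dt)>0$. Define $$H(t)=\frac{[\psi_{p,q}(a+bt)]^{\alpha}}{[\psi_{p,q}(c+dt)]^{\beta}},\qquad t\in[0,\infty).$$ Then $H$ is nondecreasing on $[0,\infty)$, and for every $t\in[0,1]$ the inequalities $$\frac{[\psi_{p,q}(a)]^{\alpha}}{[\psi_{p,q}(c)]^{\beta}}\leq \frac{[\psi_{p,q}(a+bt)]^{\alpha}}{[\psi_{p,q}(c+dt)]^{\beta}}\leq \frac{[\psi_{p,q}(a+b)]^{\alpha}}{[\psi_{p,q}(c+d)]^{\beta}}$$ hold.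
   Context: For $q\in(0,1)$ and real $x$, let $[x]_q=\frac{1-q^x}{1-q}$, and for a positive integer $p$ let $[p]_q!=[1]_q[2]_q\cdots[p]_q$. The $(p,q)$-Gamma function is $$\Gamma_{p,q}(t)=\frac{[p]_q^{t}\,[p]_q!}{[t]_q[t+1]_q\cdots[t+p]_q},\qquad t>0,$$ and the $(p,q)$-digamma function is $\psi_{p,q}(t)=\frac{d}{dt}\ln\Gamma_{p,q}(t)=\Gamma_{p,q}'(t)/\Gamma_{p,q}(t)$ for $t>0$. *)

(* Defs.v *)
From Stdlib Require Import Reals.
From Coquelicot Require Import Coquelicot.

Open Scope R_scope.

Definition qnum (q x : R) : R := (1 - Rpower q x) / (1 - q).

Fixpoint qfact (q : R) (n : nat) : R :=
  match n with
  | O => 1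
  | S m => qfact q m * qnum q (INR (S m))
  end.

(* [prod_f_R0 f p] is the product of the p + 1 factors f 0, ..., f p. *)
Definition pqGamma (p : nat) (q t : R) : R :=
  Rpower (qnum q (INR p)) t * qfact q p
  / prod_f_R0 (fun k => qnum q (t + INR k)) p.

(* Meaningful for 0 < t, where [pqGamma p q] is positive and smooth; [Derive]
   and [ln] take default values outside their domains. *)
Definition pqdigamma (p : nat) (q t : R) : R :=
  Derive (fun s => ln (pqGamma p q s)) t.

(* Main.v *)
Require Import Defs.
From Stdlib Require Import Reals Lra.
From Coquelicot Require Import Coquelicot.

Open Scope R_scope.

(** Write [x_k = q ^ (t + k)].  Taking logarithms in the definition of the
    [(p,q)]-Gamma function and differentiating term by term gives
    [psi t = ln [p]_q + ln q * sum_k x_k / (1 - x_k)]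
    ([pqdigamma_closed_form]), and differentiating once more gives
    [psi' t = (ln q)^2 * sum_k x_k / (1 - x_k)^2].
    Since [x / (1 - x)^2] increases with [x] on [(0, 1)] and each [x_k]
    decreases with [t], [psi'] is nonnegative and nonincreasing: [psi] is
    nondecreasing and concave.  Hence the logarithmic derivative [psi' / psi]
    is nonincreasing wherever [psi] is positive.  The derivative of [ln H] is
    [alpha b (psi'/psi)(a + b t) - beta d (psi'/psi)(c + d t)], and it is
    nonnegative because [a + b t <= c + d t] and [beta d <= alpha b].  The
    two-sided bound is the monotonicity of [H] between [0], [t] and [1]. *)

(** * Finite sums and products *)

Lemma prod_f_R0_pos (f : nat -> R) (n : nat) :
  (forall k, 0 < f k) -> 0 < prod_f_R0 f n.
Proof.
  intros Hf; induction n as [|n IH]; simpl; auto.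
  now apply Rmult_lt_0_compat.
Qed.

Lemma opp_ln_prod_f_R0 (f : nat -> R) (n : nat) :
  (forall k, 0 < f k) ->
  - ln (prod_f_R0 f n) = sum_f_R0 (fun k => - ln (f k)) n.
Proof.
  intros Hf; induction n as [|n IH]; simpl; auto.
  rewrite ln_mult, Ropp_plus_distr, IH; auto using prod_f_R0_pos.
Qed.

Lemma is_derive_sum_f_R0 (f g : nat -> R -> R) (n : nat) (t : R) :
  (forall k, is_derive (f k) t (g k t)) ->
  is_derive (fun s => sum_f_R0 (fun k => f k s) n) t
            (sum_f_R0 (fun k => g k t) n).
Proof.
  intros Hf; induction n as [|n IH]; simpl; auto.
  now apply @is_derive_plus.
Qed.

(** * Derivatives of the digamma function *)

Lemma exp_nondecreasing (x y : R) : x <= y -> exp x <= exp y.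
Proof.
  intros [Hxy | ->]; [left; now apply exp_increasing | apply Rle_refl].
Qed.

Lemma Rpower_base_lt_1 (q x : R) : 0 < q < 1 -> 0 < x -> 0 < Rpower q x < 1.
Proof.
  intros Hq Hx; split; [apply exp_pos|].
  unfold Rpower; rewrite <- exp_0; apply exp_increasing.
  assert (Hl : ln q < 0) by (rewrite <- ln_1; apply ln_increasing; lra).
  nra.
Qed.

Lemma Rpower_base_antitone (q x y : R) :
  0 < q < 1 -> x <= y -> Rpower q y <= Rpower q x.
Proof.
  intros Hq Hxy; unfold Rpower.
  assert (Hl : ln q < 0) by (rewrite <- ln_1; apply ln_increasing; lra).
  apply exp_nondecreasing; nra.
Qed.

Lemma qnum_pos (q x : R) : 0 < q < 1 -> 0 < x -> 0 < qnum q x.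
Proof.
  intros Hq Hx; pose proof (Rpower_base_lt_1 q x Hq Hx).
  apply Rdiv_lt_0_compat; lra.
Qed.

Lemma qfact_pos (q : R) (n : nat) : 0 < q < 1 -> 0 < qfact q n.
Proof.
  intros Hq; induction n as [|n IH]; simpl qfact; [lra|].
  apply Rmult_lt_0_compat; [exact IH|].
  apply qnum_pos; [exact Hq | apply (lt_0_INR (S n)), Nat.lt_0_succ].
Qed.

Lemma plus_INR_pos (t : R) (k : nat) : 0 < t -> 0 < t + INR k.
Proof. intros Ht; pose proof (pos_INR k); lra. Qed.

Lemma ln_pqGamma (p : nat) (q t : R) :
  0 < q < 1 -> 0 < t ->
  ln (pqGamma p q t) =
  t * ln (qnum q (INR p)) + ln (qfact q p)
  + sum_f_R0 (fun k => - ln (qnum q (t + INR k))) p.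
Proof.
  intros Hq Ht.
  assert (Hf : forall k, 0 < qnum q (t + INR k))
    by (intros k; apply qnum_pos; auto using plus_INR_pos).
  pose proof (qfact_pos q p Hq) as Hfact.
  assert (Hpow : 0 < Rpower (qnum q (INR p)) t) by apply exp_pos.
  unfold pqGamma.
  rewrite ln_div, ln_mult by auto using prod_f_R0_pos, Rmult_lt_0_compat.
  unfold Rminus, Rpower; now rewrite ln_exp, opp_ln_prod_f_R0.
Qed.

Lemma is_derive_opp_ln_qnum (q s t : R) :
  0 < q < 1 -> 0 < t + s ->
  is_derive (fun t => - ln (qnum q (t + s))) t
    (ln q * (Rpower q (t + s) / (1 - Rpower q (t + s)))).
Proof.
  intros Hq Ht; pose proof (qnum_pos q _ Hq Ht) as Hn.
  pose proof (Rpower_base_lt_1 q _ Hq Ht) as Hx.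
  unfold qnum, Rpower in *; auto_derive.
  - exact Hn.
  - field; lra.
Qed.

Definition pqdigamma_series (p : nat) (q t : R) : R :=
  ln (qnum q (INR p))
  + sum_f_R0 (fun k => ln q * (Rpower q (t + INR k) / (1 - Rpower q (t + INR k)))) p.

Definition pqtrigamma (p : nat) (q t : R) : R :=
  sum_f_R0 (fun k =>
    (ln q)^2 * (Rpower q (t + INR k) / (1 - Rpower q (t + INR k))^2)) p.

Lemma pqdigamma_closed_form (p : nat) (q t : R) :
  0 < q < 1 -> 0 < t -> pqdigamma p q t = pqdigamma_series p q t.
Proof.
  intros Hq Ht; unfold pqdigamma; apply is_derive_unique.
  (* The logarithm splits only at positive arguments, hence the passage to a
     neighbourhood of [t]. *)
  apply is_derive_ext_loc with (fun s =>
    (s * ln (qnum q (INR p)) + ln (qfact q p))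
    + sum_f_R0 (fun k => - ln (qnum q (s + INR k))) p).
  - apply (filter_imp (fun s => 0 < s)).
    + intros s Hs; symmetry; now apply ln_pqGamma.
    + now apply (open_gt 0).
  - apply @is_derive_plus.
    + auto_derive; [exact I | ring].
    + apply (is_derive_sum_f_R0 (fun k s => - ln (qnum q (s + INR k)))
        (fun k s => ln q * (Rpower q (s + INR k) / (1 - Rpower q (s + INR k))))).
      intros k; apply is_derive_opp_ln_qnum; auto using plus_INR_pos.
Qed.

Lemma is_derive_pqdigamma (p : nat) (q t : R) :
  0 < q < 1 -> 0 < t -> is_derive (pqdigamma p q) t (pqtrigamma p q t).
Proof.
  intros Hq Ht.
  apply is_derive_ext_loc with (pqdigamma_series p q).
  - apply (filter_imp (fun s => 0 < s)).
    + intros s Hs; symmetry; now apply pqdigamma_closed_form.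
    + now apply (open_gt 0).
  - unfold pqdigamma_series.
    replace (pqtrigamma p q t) with (0 + pqtrigamma p q t) by ring.
    apply @is_derive_plus; [apply @is_derive_const|].
    apply (is_derive_sum_f_R0
      (fun k s => ln q * (Rpower q (s + INR k) / (1 - Rpower q (s + INR k))))
      (fun k s => (ln q)^2 * (Rpower q (s + INR k) / (1 - Rpower q (s + INR k))^2))).
    intros k.
    pose proof (Rpower_base_lt_1 q _ Hq (plus_INR_pos t k Ht)) as Hx.
    unfold Rpower in *; auto_derive; [lra | field; lra].
Qed.

(** * Monotonicity of the digamma function and of its derivative *)

Lemma pqtrigamma_nonneg (p : nat) (q t : R) :
  0 < q < 1 -> 0 < t -> 0 <= pqtrigamma p q t.
Proof.
  intros Hq Ht; apply cond_pos_sum; intros k.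
  pose proof (Rpower_base_lt_1 q _ Hq (plus_INR_pos t k Ht)) as Hx.
  apply Rmult_le_pos; [apply pow2_ge_0|].
  apply Rlt_le, Rdiv_lt_0_compat; [lra | apply pow_lt; lra].
Qed.

(** Concavity of the digamma function. *)
Lemma pqtrigamma_antitone (p : nat) (q x y : R) :
  0 < q < 1 -> 0 < x -> x <= y -> pqtrigamma p q y <= pqtrigamma p q x.
Proof.
  intros Hq Hx Hxy; apply sum_Rle; intros k _.
  assert (Hy : 0 < y) by lra.
  pose proof (Rpower_base_lt_1 q _ Hq (plus_INR_pos x k Hx)) as Hu.
  pose proof (Rpower_base_lt_1 q _ Hq (plus_INR_pos y k Hy)) as Hv.
  assert (Hvu : Rpower q (y + INR k) <= Rpower q (x + INR k))
    by (apply Rpower_base_antitone; lra).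
  set (u := Rpower q (x + INR k)) in *; set (v := Rpower q (y + INR k)) in *.
  apply Rmult_le_compat_l; [apply pow2_ge_0|].
  apply Rmult_le_compat; [lra | | exact Hvu |].
  - apply Rlt_le, Rinv_0_lt_compat, pow_lt; lra.
  - apply Rinv_le_contravar; [apply pow_lt; lra | apply pow_incr; lra].
Qed.

Lemma nondecreasing_of_derive_nonneg (f df : R -> R) (x y : R) :
  (forall t, x <= t <= y -> is_derive f t (df t)) ->
  (forall t, x <= t <= y -> 0 <= df t) ->
  x <= y -> f x <= f y.
Proof.
  intros Hf Hdf Hxy.
  destruct (MVT_gen f x y df) as [z [Hz Heq]];
    rewrite ?Rmin_left, ?Rmax_right in * by assumption.
  - intros t Ht; apply Hf; lra.
  - intros t Ht; apply continuity_pt_filterlim.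
    apply (ex_derive_continuous f t); exists (df t); now apply Hf.
  - pose proof (Hdf z Hz); nra.
Qed.

Lemma pqdigamma_nondecreasing (p : nat) (q x y : R) :
  0 < q < 1 -> 0 < x -> x <= y -> pqdigamma p q x <= pqdigamma p q y.
Proof.
  intros Hq Hx.
  apply (nondecreasing_of_derive_nonneg _ (pqtrigamma p q)); intros t Ht.
  - apply is_derive_pqdigamma; lra.
  - apply pqtrigamma_nonneg; lra.
Qed.

(** The numerator of the logarithmic derivative decreases and its denominator
    increases. *)
Lemma pqdigamma_log_derivative_antitone (p : nat) (q x y : R) :
  0 < q < 1 -> 0 < x -> x <= y -> 0 < pqdigamma p q x ->
  pqtrigamma p q y / pqdigamma p q y <= pqtrigamma p q x / pqdigamma p q x.
Proof.
  intros Hq Hx Hxy Hpos.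
  pose proof (pqdigamma_nondecreasing p q x y Hq Hx Hxy) as Hle.
  apply Rmult_le_compat.
  - apply pqtrigamma_nonneg; lra.
  - apply Rlt_le, Rinv_0_lt_compat; lra.
  - now apply pqtrigamma_antitone.
  - now apply Rinv_le_contravar.
Qed.

(** * Monotonicity of the ratio *)

Lemma Rpower_ratio_exp (x y alpha beta : R) :
  Rpower x alpha / Rpower y beta = exp (alpha * ln x - beta * ln y).
Proof.
  unfold Rpower, Rminus, Rdiv; now rewrite exp_plus, exp_Ropp.
Qed.

Lemma is_derive_ln_pqdigamma_affine (p : nat) (q a b t : R) :
  0 < q < 1 -> 0 < a + b * t -> 0 < pqdigamma p q (a + b * t) ->
  is_derive (fun s => ln (pqdigamma p q (a + b * s))) t
    (b * (pqtrigamma p q (a + b * t) / pqdigamma p q (a + b * t))).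
Proof.
  intros Hq Harg Hpos.
  pose proof (is_derive_pqdigamma p q _ Hq Harg) as Hd.
  auto_derive.
  - repeat split; auto; now exists (pqtrigamma p q (a + b * t)).
  - replace (Derive _ _) with (pqtrigamma p q (a + b * t))
      by (symmetry; now apply is_derive_unique).
    field; lra.
Qed.

Theorem theorem2p9 (q : R) (p : nat) (a b c d alpha beta : R)
  (hq : 0 < q < 1) (hp : (0 < p)%nat)
  (ha : 0 < a) (hb : 0 < b) (hc : 0 < c) (hd : 0 < d)
  (halpha : 0 < alpha) (hbeta : 0 < beta)
  (hle : beta * d <= alpha * b)
  (hle_arg : forall t : R, 0 <= t -> a + b * t <= c + d * t)
  (hpos_ab : forall t : R, 0 <= t -> 0 < pqdigamma p q (a + b * t))
  (hpos_cd : forall t : R, 0 <= t -> 0 < pqdigamma p q (c + d * t)) :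
  let H := fun t : R =>
    Rpower (pqdigamma p q (a + b * t)) alpha
    / Rpower (pqdigamma p q (c + d * t)) beta in
  (forall s t : R, 0 <= s -> s <= t -> H s <= H t) /\
  (forall t : R, 0 <= t <= 1 ->
     Rpower (pqdigamma p q a) alpha / Rpower (pqdigamma p q c) beta
     <= Rpower (pqdigamma p q (a + b * t)) alpha
        / Rpower (pqdigamma p q (c + d * t)) beta
     <= Rpower (pqdigamma p q (a + b)) alpha
        / Rpower (pqdigamma p q (c + d)) beta).
Proof.
  intros H.
  assert (Hmono : forall s t : R, 0 <= s -> s <= t -> H s <= H t).
  { intros s t Hs Hst; unfold H; rewrite !Rpower_ratio_exp.
    apply exp_nondecreasing.
    set (x := fun r => a + b * r); set (y := fun r => c + d * r).
    apply (nondecreasing_of_derive_nonneg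
      (fun r => alpha * ln (pqdigamma p q (x r)) - beta * ln (pqdigamma p q (y r)))
      (fun r => alpha * (b * (pqtrigamma p q (x r) / pqdigamma p q (x r)))
              - beta * (d * (pqtrigamma p q (y r) / pqdigamma p q (y r)))));
      [intros r Hr | intros r Hr | exact Hst];
      assert (Hr0 : 0 <= r) by lra;
      assert (Hx : 0 < x r) by (unfold x; nra);
      assert (Hy : 0 < y r) by (unfold y; nra);
      pose proof (hpos_ab r Hr0) as Hpx; pose proof (hpos_cd r Hr0) as Hpy.
    - apply @is_derive_minus; apply is_derive_scal;
        now apply is_derive_ln_pqdigamma_affine.
    - pose proof (pqdigamma_log_derivative_antitone p q (x r) (y r)
        hq Hx (hle_arg r Hr0) Hpx) as Hlog.
      assert (Hnn : 0 <= pqtrigamma p q (y r) / pqdigamma p q (y r))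
        by (apply Rdiv_le_0_compat; [now apply pqtrigamma_nonneg | exact Hpy]).
      pose proof (Rmult_lt_0_compat _ _ halpha hb) as Hab.
      (* [beta d psi'/psi (y) <= alpha b psi'/psi (y) <= alpha b psi'/psi (x)] *)
      nra. }
  split; [exact Hmono|].
  intros t Ht.
  pose proof (Hmono 0 t ltac:(lra) ltac:(lra)) as H0.
  pose proof (Hmono t 1 ltac:(lra) ltac:(lra)) as H1.
  unfold H in H0, H1.
  rewrite !Rmult_0_r, !Rplus_0_r in H0; rewrite !Rmult_1_r in H1.
  now split.
Qed.
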